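(* Let $n\ge1$, let $\mathcal{E}$ be a finite-dimensional Hilbert space, and let $L\in\mathcal{B}(\mathcal{E},\mathcal{F}^2_n\otimes\mathcal{E})$ be such that $(W_L,S^{\mathcal{E}})$ is an isometric Fock representation of $O_n$. Then the following are equivalent: (1) $(W_L,S^{\mathcal{E}})$ is a Nica-covariant representation of $O_n$. (2) $L:\mathcal{E}\to\Omega\otimes\mathcal{E}$ is a unitary (that is, $L$ maps $\mathcal{E}$ into $\Omega\otimes\mathcal{E}$ and is unitary as an operator from $\mathcal{E}$ onto $\Omega\otimes\mathcal{E}$). (3) $W_L$ is a unitary.
   Context: All Hilbert spaces are complex. $F_n^+$ is the free semigroup on letters $g_1,\dots,g_n$ with identity $g_0$. The Fock space is $\mathcal{F}^2_n=\mathbb{C}\Omega\oplus\bigoplus_{k\ge1}(\mathbb{C}^n)^{\otimes k}$ with vacuum unit vector $\Omega$; $\{e_1,\dots,e_n\}$ is the standard basis of $\mathbb{C}^n$; $e_\mu=e_{\mu_1}\otimes\cdots\otimes e_{\mu_k}$ for $\mu=g_{\mu_1}\cdots g_{\mu_k}$ and $e_{g_0}=\Omega$; the $e_\mu$ form an orthonormal basis. The creation operators are $S_if=e_i\otimes f$, and $S^{\mathcal{E}}=(S_1\otimes I_{\mathcal{E}},\dots,S_n\otimes I_{\mathcal{E}})$. The vector $e_1^{\otimes m}\otimes L\eta$ means $(S_1^m\otimes I_{\mathcal{E}})L\eta$. Odometer map: for $L\in\mathcal{B}(\mathcal{E},\mathcal{F}^2_n\otimes\mathcal{E})$, $W_L$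 is the linear map on the dense linear span of $\{e_\mu\otimes\eta:\mu\in F_n^+,\eta\in\mathcal{E}\}$ given by $W_L(\Omega\otimes\eta)=L\eta$; $W_L(e_n^{\otimes m}\otimes\eta)=e_1^{\otimes m}\otimes L\eta$ for $m\ge1$; and $W_L(e_n^{\otimes j}\otimes e_i\otimes e_\nu\otimes\eta)=e_1^{\otimes j}\otimes e_{i+1}\otimes e_\nu\otimes\eta$ for $j\ge0$, $1\le i\le n-1$, $\nu\in F_n^+$. When this map is bounded, $W_L$ also denotes its bounded extension to $\mathcal{F}^2_n\otimes\mathcal{E}$. $(W,T)$ with $T=(T_1,\dots,T_n)$ is a representation of the odometer semigroup $O_n$ if $WT_i=T_{i+1}$ for $1\le i\le n-1$ and $WT_n=T_1W$. An isometric Fock representation is a representation $(W,S^{\mathcal{E}})$ with $W$ an isometry on $\mathcal{F}^2_n\otimes\mathcal{E}$. An isometric Fock representation $(W,S^{\mathcal{E}})$ is a Nica-covariant representation of $O_n$ if $W^*(S_1\otimes I_{\mathcal{E}})=(S_n\otimes I_{\mathcal{E}})W^*$. *)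

(* Defs.v *)
From HB Require Import structures.
From mathcomp Require Import all_boot all_order all_algebra.
From mathcomp Require Import complex.
From mathcomp Require Import all_classical all_reals all_analysis.
From mathcomp Require Import ring.
Set Implicit Arguments.
Unset Strict Implicit.
Unset Printing Implicit Defensive.
Import Order.TTheory GRing.Theory Num.Theory.
Import numFieldNormedType.Exports.
Local Open Scope ring_scope.
Local Open Scope classical_set_scope.

(* Inner products are linear in the first argument. *)

Section ScalarDot.
Variable C : numClosedFieldType.

Definition cdot (x y : C^o) : C := x * y^*.

Let cdot_bilinear : bilinear_for
  (GRing.Scale.Law.clone C C *%R _)
  (GRing.Scale.Law.clone C C (Num.conj \; *%R) _) cdot.
Proof.
split=> [y a x x'|x a y y']; rewrite /cdot /=.
  by rewrite mulrDl mulrA.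
by rewrite rmorphD rmorphM mulrDr mulrCA.
Qed.

HB.instance Definition _ :=
  @bilinear_isBilinear.Build C C^o C^o C _ _ cdot cdot_bilinear.

Let cdot_herm x y : cdot x y = (-1) ^+ false * (cdot y x)^*.
Proof. by rewrite expr0 mul1r /cdot rmorphM /= conjCK mulrC. Qed.

HB.instance Definition _ :=
  @isHermitianSesquilinear.Build C C^o false Num.conj cdot cdot_herm.

Let cdot_gt0 x : x != 0 -> 0 < cdot x x.
Proof. by move=> x0; rewrite /cdot -normCK exprn_gt0// normr_gt0. Qed.

HB.instance Definition _ := @isDotProduct.Build C C^o cdot cdot_gt0.

End ScalarDot.

Section PartialDot.
Variables (C : numClosedFieldType) (n : nat) (E : lmodType C).
Variable dE : {dot E for Num.conj}.
Implicit Types f g h : seq 'I_n -> E.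

(* Words in the letters g_1, ..., g_n are lists over 'I_n, the letter g_(i+1)
   being i. pdot N is the inner product of the truncations to the summands
   (C^n)^{\otimes k} \otimes E with k < N, where (C^n)^{\otimes k} has the
   words of length k as orthonormal basis. *)
Definition pdot N f g : C :=
  \sum_(k < N) \sum_(t : k.-tuple 'I_n) dE (f t) (g t).

Definition sqsum f : Prop := exists M : C, forall N, pdot N f f <= M.

Lemma pdotPl N a f g h : pdot N (a *: f + g) h = a * pdot N f h + pdot N g h.
Proof.
rewrite /pdot mulr_sumr -big_split; apply: eq_bigr => k _ /=.
by rewrite mulr_sumr -big_split; apply: eq_bigr => t _ /=; rewrite linearPl.
Qed.

Lemma pdot_conj N f g : pdot N f g = (pdot N g f)^*.
Proof.
rewrite /pdot rmorph_sum; apply: eq_bigr => k _ /=.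
by rewrite rmorph_sum; apply: eq_bigr => t _ /=; rewrite hermC /= mul1r.
Qed.

Lemma pdot_ge0 N f : 0 <= pdot N f f.
Proof. by apply: sumr_ge0 => k _; apply: sumr_ge0 => t _; exact: dnorm_ge0. Qed.

Lemma pdotPr N a f g h :
  pdot N h (a *: f + g) = a^* * pdot N h f + pdot N h g.
Proof.
rewrite /pdot mulr_sumr -big_split; apply: eq_bigr => k _ /=.
by rewrite mulr_sumr -big_split; apply: eq_bigr => t _ /=; rewrite linearPr.
Qed.

Lemma pdotD N f g : pdot N (f + g) (f + g) =
  pdot N f f + pdot N g g + pdot N f g + pdot N g f.
Proof.
rewrite -[X in pdot N (X + _)]scale1r -[X in pdot N _ (X + _)]scale1r.
by rewrite !pdotPl !pdotPr rmorph1; ring.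
Qed.

Lemma pdotZ N a f : pdot N (a *: f) (a *: f) = `|a| ^+ 2 * pdot N f f.
Proof.
rewrite /pdot mulr_sumr; apply: eq_bigr => k _ /=.
by rewrite mulr_sumr; apply: eq_bigr => t _ /=; rewrite dnormZ.
Qed.

Lemma sqsum0 : sqsum 0.
Proof.
exists 0 => N; rewrite /pdot big1// => k _; rewrite big1// => t _.
by rewrite linear0l.
Qed.

Lemma sqsumZ a f : sqsum f -> sqsum (a *: f).
Proof.
case=> M fM; exists (`|a| ^+ 2 * M) => N; rewrite pdotZ.
by rewrite ler_wpM2l ?exprn_ge0.
Qed.

Lemma sqsumD f g : sqsum f -> sqsum g -> sqsum (f + g).
Proof.
move=> [M fM] [M' gM]; exists (2 * (M + M')) => N.
have /le_trans : pdot N (f + g) (f + g) <= 2 * (pdot N f f + pdot N g g).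
  rewrite -subr_ge0.
  have <- : pdot N (f + (-1) *: g) (f + (-1) *: g) =
      2 * (pdot N f f + pdot N g g) - pdot N (f + g) (f + g).
    rewrite [f + _ *: g]addrC pdotPl !pdotPr pdotD rmorphN rmorph1.
    ring.
  exact: pdot_ge0.
by apply; rewrite ler_wpM2l// lerD.
Qed.

End PartialDot.

Section FockType.
Variables (C : numClosedFieldType) (n : nat) (E : lmodType C).
Variable dE : {dot E for Num.conj}.

Definition sqsum_pred : {pred seq 'I_n -> E} := fun f => `[< sqsum dE f >].

Let sqsum_submod : submod_closed sqsum_pred.
Proof.
split=> [|a f g]; first exact/asboolP/sqsum0.
by move=> /asboolP fM /asboolP gM; apply/asboolP/sqsumD => //; exact: sqsumZ.
Qed.

HB.instance Definition _ :=
  GRing.isSubmodClosed.Build C (seq 'I_n -> E) sqsum_pred sqsum_submod.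

(* F^2_n \otimes E for a Hilbert space E, realized as the square-summable
   families of vectors of E indexed by words: coeff f w is the coefficient x_w in
   f = \sum_w e_w \otimes x_w. The tensor product map is tens below, with
   <f \otimes x, g \otimes y> = <f, g> <x, y> (fdot_tens) and total range
   (tens_evec_total). *)
Record fock := Fock { coeff :> seq 'I_n -> E; _ : coeff \in sqsum_pred }.

HB.instance Definition _ := [isSub for coeff].
HB.instance Definition _ := [Choice of fock by <:].
HB.instance Definition _ := [SubChoice_isSubLmodule of fock by <:].

Lemma fockP (f : fock) : sqsum dE f. Proof. exact/asboolP/(valP f). Qed.

Lemma fock_ext (f g : fock) : f =1 g -> f = g.
Proof. by move=> fg; apply/val_inj/funext. Qed.

Definition to_fock f (fM : sqsum dE f) : fock := Fock (asboolT fM).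

End FockType.

Section FockDot.
Variables (C : numClosedFieldType) (n : nat) (E : lmodType C).
Variable dE : {dot E for Num.conj}.
Local Notation K := (fock n dE).
Implicit Types f g h : K.

Definition fdot f g : C := limn (fun N => pdot dE N f g).

Lemma pdot_homo f : {homo (fun N => pdot dE N f f) : m p / (m <= p)%N >-> m <= p}.
Proof.
apply: homo_leq => [//|x y z|N]; first exact: le_trans.
rewrite {2}/pdot big_ord_recr lerDl sumr_ge0 => // t _; exact: dnorm_ge0.
Qed.

Lemma cvg_polar f g :
  (forall h, cvgn (fun N => pdot dE N h h)) -> cvgn (fun N => pdot dE N f g).
Proof.
move=> cv; have -> : (fun N => pdot dE N f g) = (fun N => 2^-1 *:
   ((pdot dE N (f + g) (f + g) - (pdot dE N f f + pdot dE N g g)) +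
   'i *: (pdot dE N ('i *: g + f) ('i *: g + f) - (pdot dE N f f + pdot dE N g g)) : C^o)).
  apply/funext => N; rewrite pdotD pdotPl !pdotPr conjCi.
  apply: (mulfI (x := 2)); first by rewrite pnatr_eq0.
  rewrite /GRing.scale/= mulrA mulfV ?pnatr_eq0// mul1r.
  have i2 : 'i * 'i = -1 :> C by rewrite -expr2 sqrCi.
  by ring: i2.
apply: is_cvgZl_tmp; apply: is_cvgD.
  by apply: is_cvgB; [exact: cv|apply: is_cvgD; exact: cv].
apply: is_cvgZl_tmp.
by apply: is_cvgB; [exact: cv|apply: is_cvgD; exact: cv].
Qed.

Hypothesis cvgH : forall h : K, cvgn (fun N => pdot dE N h h).

Let cvg_fdot f g : (fun N => pdot dE N f g) @ \oo --> fdot f g.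
Proof. exact: cvg_polar. Qed.

Lemma fdotPl_subproof a f g h : fdot (a *: f + g) h = a * fdot f h + fdot g h.
Proof.
apply/cvg_lim => //.
under eq_fun do rewrite pdotPl.
by apply: cvgD; [apply: cvgMl_tmp|]; exact: cvg_fdot.
Qed.

Lemma fdot_herm_subproof f g : fdot f g = (fdot g f)^*.
Proof.
apply/cvg_lim => //.
under eq_fun do rewrite pdot_conj.
apply/cvgrPdist_lt => e e0.
have /cvgrPdist_lt/(_ e e0) := @cvg_fdot g f.
by apply: filterS => N; rewrite -rmorphB norm_conjC.
Qed.

Lemma fdotPr_subproof a f g h : fdot h (a *: f + g) = a^* * fdot h f + fdot h g.
Proof.
rewrite fdot_herm_subproof fdotPl_subproof rmorphD rmorphM /=.
by rewrite -!fdot_herm_subproof.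
Qed.

Hypothesis fdot_geH : forall (h : K) N, pdot dE N h h <= fdot h h.

Lemma fdot_gt0_subproof f : f != 0 -> 0 < fdot f f.
Proof.
move=> f0; have [w fw0] : exists w, f w != 0.
  apply: contrapT => nf; case/eqP: f0; apply: fock_ext => w.
  by apply/eqP/negPn/negP => fw; apply: nf; exists w.
apply: lt_le_trans (fdot_geH f (size w).+1).
rewrite /pdot (bigD1 ord_max)//= (bigD1 (in_tuple w))//= -addrA.
rewrite ltr_pwDl ?dnorm_gt0// addr_ge0// sumr_ge0// => *; last exact: sumr_ge0.
Qed.

End FockDot.

Section ComplexFock.
Variables (R : realType) (n : nat) (E : lmodType R[i]).
Variable dE : {dot E for Num.conj}.
Local Notation K := (fock n dE).

Let cvg_re (f : K) : exists2 l : R,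
  (fun N => pdot dE N f f : (R[i] : numClosedFieldType)) @ \oo -->
    (real_complex R l : (R[i] : numClosedFieldType)) &
  forall N, pdot dE N f f <= real_complex R l.
Proof.
pose r N := complex.Re (pdot dE N f f).
have rE N : pdot dE N f f = real_complex R (r N).
  by apply/esym/RRe_real/ger0_real/pdot_ge0.
have rhomo : {homo r : m p / (m <= p)%N >-> m <= p}.
  by move=> m p /(pdot_homo f); rewrite !rE lecR.
have rub : has_ubound (range r).
  have [M fM] := fockP f; exists (complex.Re M) => _ [N _ <-].
  by have := fM N; rewrite rE lecE => /andP[].
exists (sup (range r)); last first.
  by move=> N; rewrite rE lecR; apply: ub_le_sup => //; exists N.
have /cvgrPdist_lt rcvg := nondecreasing_cvgn rhomo rub.
apply/cvgrPdist_lt => /= e e0.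
have eE : e = real_complex R (complex.Re e) by apply/esym/RRe_real/gtr0_real.
have e0' : 0 < complex.Re e by rewrite -ltcR -eE.
apply: filterS (rcvg _ e0') => N.
by rewrite rE -rmorphB normc_def /= expr0n /= addr0 sqrtr_sqr eE ltcR.
Qed.

Let cvgH (f : K) : cvgn (fun N => pdot dE N f f : (R[i] : numClosedFieldType)).
Proof. by have [l fl _] := cvg_re f; apply/cvg_ex; exists (real_complex R l). Qed.

Lemma cvg_pdot (f g : K) :
  (fun N => pdot dE N f g : (R[i] : numClosedFieldType)) @ \oo -->
    (fdot f g : (R[i] : numClosedFieldType)).
Proof. exact/cvg_polar/cvgH. Qed.

Let geH (f : K) N : pdot dE N f f <= fdot f f.
Proof.
have [l fl fle] := cvg_re f; suff -> : fdot f f = real_complex R l by [].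
exact/cvg_lim.
Qed.

Let fdot_bilinear : bilinear_for
  (GRing.Scale.Law.clone R[i] R[i] *%R _)
  (GRing.Scale.Law.clone R[i] R[i] (Num.conj \; *%R) _) (@fdot R[i] n E dE).
Proof.
split=> [h a f g|h a f g]; first exact: fdotPl_subproof.
exact: fdotPr_subproof.
Qed.

HB.instance Definition _ :=
  @bilinear_isBilinear.Build R[i] K K R[i] _ _ (@fdot R[i] n E dE) fdot_bilinear.

Let fdot_herm (f g : K) : fdot f g = (-1) ^+ false * (fdot g f)^*.
Proof. by rewrite expr0 mul1r; exact: fdot_herm_subproof. Qed.

HB.instance Definition _ :=
  @isHermitianSesquilinear.Build R[i] K false Num.conj (@fdot R[i] n E dE) fdot_herm.

HB.instance Definition _ :=
  @isDotProduct.Build R[i] K (@fdot R[i] n E dE) (fdot_gt0_subproof geH).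

End ComplexFock.

Section Vectors.
Variables (C : numClosedFieldType) (n : nat) (E : lmodType C).
Variable dE : {dot E for Num.conj}.
Implicit Types (w v : seq 'I_n) (x y : E).

Definition delta w x : seq 'I_n -> E := fun v => if v == w then x else 0.

Lemma pdot_delta N w x (g : seq 'I_n -> E) :
  pdot dE N (delta w x) g = if (size w < N)%N then dE x (g w) else 0.
Proof.
case: ltnP => wN; last first.
  rewrite /pdot big1// => k _; rewrite big1// => t _; rewrite /delta.
  case: eqP => [tw|_]; last by rewrite linear0l.
  suff: (size w < N)%N by rewrite ltnNge wN.
  by rewrite -tw size_tuple.
rewrite /pdot (bigD1 (Ordinal wN))//= (bigD1 (in_tuple w))//= /delta eqxx.
rewrite big1 => [|t tw]; last first.
  by rewrite ifN ?linear0l//; apply: contra_neq tw => tw; apply: val_inj.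
rewrite addr0 big1 ?addr0// => k kw; rewrite big1// => t _.
rewrite ifN ?linear0l//; apply: contra_neq kw => tw.
by apply: val_inj => /=; rewrite -tw size_tuple.
Qed.

Lemma delta_sqsum w x : sqsum dE (delta w x).
Proof.
exists (dE x x) => N; rewrite pdot_delta /delta eqxx.
by case: ifP => // _; exact: dnorm_ge0.
Qed.

End Vectors.

Section Tensor.
Variables (C : numClosedFieldType) (n : nat) (E : lmodType C).
Variable dE : {dot E for Num.conj}.

(* F^2_n itself is the case E = C; evec w is e_w, and evec [::] is Omega. *)
Definition fock2 := fock n (@cdot C).

Definition evec (w : seq 'I_n) : fock2 :=
  to_fock (delta_sqsum (@cdot C) w (1 : C^o)).

Lemma pdot_tens N (f g : seq 'I_n -> C^o) (x y : E) :
  pdot dE N (fun w => f w *: x) (fun w => g w *: y) =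
  pdot (@cdot C) N f g * dE x y.
Proof.
rewrite /pdot mulr_suml; apply: eq_bigr => k _.
rewrite mulr_suml; apply: eq_bigr => t _.
by rewrite linearZl_LR linearZr_LR /= mulrA.
Qed.

Lemma tens_sqsum (f : fock2) (x : E) : sqsum dE (fun w => f w *: x).
Proof.
have [M fM] := fockP f; exists (M * dE x x) => N.
by rewrite pdot_tens ler_wpM2r ?dnorm_ge0.
Qed.

Definition tens (f : fock2) (x : E) : fock n dE := to_fock (tens_sqsum f x).

(* The coefficients of e_i \otimes f. *)
Definition shift i (f : seq 'I_n -> E) : seq 'I_n -> E :=
  fun w => if w is j :: v then if j == i then f v else 0 else 0.

Lemma pdot_shift N i (f g : seq 'I_n -> E) :
  pdot dE N.+1 (shift i f) (shift i g) = pdot dE N f g.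
Proof.
rewrite /pdot big_ord_recl big1 => [|t _]; last by rewrite tuple0 linear0l.
rewrite add0r; apply: eq_bigr => k _ /=.
rewrite (reindex (fun p : 'I_n * k.-tuple 'I_n => cons_tuple p.1 p.2)) /=; last first.
  exists (fun t : k.+1.-tuple 'I_n => (thead t, behead_tuple t)) => [[j t] _|t _] /=.
    by congr pair; apply: val_inj.
  by rewrite [RHS]tuple_eta; apply: val_inj.
rewrite -(pair_bigA _ (fun j (t : k.-tuple 'I_n) =>
  dE (if j == i then f t else 0) (if j == i then g t else 0))) /=.
rewrite (bigD1 i)//= eqxx [X in _ + X]big1 ?addr0// => j /negbTE ->.
by rewrite big1// => t _; rewrite linear0l.
Qed.

Lemma shift_sqsum i (f : fock n dE) : sqsum dE (shift i f).
Proof.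
have [M fM] := fockP f; exists M => -[|N]; last by rewrite pdot_shift.
by apply: le_trans (fM 0%N); rewrite /pdot !big_ord0.
Qed.

(* S_i \otimes I_E; it is S_i when E = C, see creation_evec and creation_tens. *)
Definition creation i (f : fock n dE) : fock n dE := to_fock (shift_sqsum i f).

Lemma creation_linear i : linear (creation i).
Proof.
move=> a f g; apply: fock_ext => w.
have -> : (a *: creation i f + creation i g) w =
  a *: shift i f w + shift i g w by [].
case: w => [|j w] /=; first by rewrite scaler0 addr0.
by case: ifP => // _; rewrite scaler0 addr0.
Qed.

HB.instance Definition _ i :=
  GRing.isLinear.Build C (fock n dE) (fock n dE) _ (creation i)
    (creation_linear i).

Lemma fdot_evec (h : fock n dE) w x : fdot (tens (evec w) x) h = dE x (h w).
Proof.
apply/cvg_lim => //; apply: cvg_near_cst; near=> N.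
have -> : (tens (evec w) x : seq 'I_n -> E) = delta w x.
  by apply/funext => v /=; rewrite /delta; case: eqP; rewrite (scale1r, scale0r).
rewrite pdot_delta ifT//; near: N; exact: nbhs_infty_gt.
Unshelve. all: by end_near. Qed.

Lemma tens_evec_total (h : fock n dE) :
  (forall w x, fdot (tens (evec w) x) h = 0) -> h = 0.
Proof.
move=> h0; apply: fock_ext => w; apply/eqP.
by rewrite -(dnorm_eq0 dE) -fdot_evec h0.
Qed.

Lemma fdot_tens_subproof (f g : fock2) (x y : E) :
  (fun N => pdot (@cdot C) N f g) @ \oo --> fdot f g ->
  fdot (tens f x) (tens g y) = fdot f g * dE x y.
Proof.
move=> cv; apply/cvg_lim => //.
under eq_fun do rewrite pdot_tens.
exact: cvgMr_tmp.
Qed.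

End Tensor.

Arguments evec {C n}.
Arguments tens {C n E} dE.

Section TensorTheory.
Variables (C : numClosedFieldType) (n : nat) (E : lmodType C).
Variable dE : {dot E for Num.conj}.

Lemma creation_evec i (w : seq 'I_n) :
  creation i (evec w) = evec (i :: w) :> fock2 C n.
Proof.
apply: fock_ext => -[|j v] //=; rewrite /delta eqseq_cons.
by case: (j == i).
Qed.

Lemma creation_tens i (f : fock2 C n) x :
  creation i (tens dE f x) = tens dE (creation i f) x.
Proof.
apply: fock_ext => -[|j v] /=; first by rewrite scale0r.
by case: ifP; rewrite ?scale0r.
Qed.

End TensorTheory.

Section ComplexTensor.
Variables (R : realType) (n : nat) (E : lmodType R[i]).
Variable dE : {dot E for Num.conj}.

Lemma evec_orthonormal (v w : seq 'I_n) :
  fdot (evec v : fock2 R[i] n) (evec w) = (v == w)%:R.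
Proof.
have -> : evec v = tens (@cdot R[i]) (evec v) (1 : R[i]^o).
  by apply: fock_ext => u /=; rewrite /GRing.scale /= mulr1.
rewrite fdot_evec /= /cdot /delta mul1r.
by case: eqP => _; rewrite (rmorph1, rmorph0).
Qed.

Lemma fdot_tens (f g : fock2 R[i] n) x y :
  fdot (tens dE f x) (tens dE g y) = fdot f g * dE x y.
Proof. exact/fdot_tens_subproof/cvg_pdot. Qed.

End ComplexTensor.

Section Operators.
Variables (C : numClosedFieldType) (U V : lmodType C).
Variables (dU : {dot U for Num.conj}) (dV : {dot V for Num.conj}).

Definition bounded_op (f : U -> V) : Prop :=
  exists M : C, forall x, sqrtC (dV (f x) (f x)) <= M * sqrtC (dU x x).

Definition is_adjoint (f : U -> V) (f' : V -> U) : Prop :=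
  forall x y, dV (f x) y = dU x (f' y).

(* f is a unitary operator from U onto the subspace A of V. *)
Definition unitary_onto (f : U -> V) (A : set V) : Prop :=
  isometry dV dU f /\ range f = A.

End Operators.

Section Odometer.
Variables (R : realType) (n : nat) (E : lmodType R[i]).
Variable dE : {dot E for Num.conj}.
Local Notation K := (fock n.+1 dE).
Local Notation dK := (@fdot R[i] n.+1 E dE).

(* There are n.+1 letters: g_1 is ord0 and the last one is ord_max. For i : 'I_n,
   lift ord_max i has value i and lift ord0 i has value i.+1, so that the pair
   (lift ord_max i, lift ord0 i) runs over the consecutive letters. *)

(* W extends the map W_L, which is determined by these clauses on the dense span
   of the vectors e_w \otimes x; hence a bounded linear such W is unique. *)
Definition odometer_map (L : E -> K) (W : K -> K) : Prop :=
  [/\ forall x, W (tens dE (evec [::]) x) = L x,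
      forall m x, (0 < m)%N ->
        W (tens dE (evec (nseq m ord_max)) x) = iter m (creation ord0) (L x) &
      forall j (i : 'I_n) w x,
        W (tens dE (evec (nseq j ord_max ++ lift ord_max i :: w)) x) =
        tens dE (evec (nseq j ord0 ++ lift ord0 i :: w)) x].

Definition odometer_rep (W : K -> K) (T : 'I_n.+1 -> K -> K) : Prop :=
  (forall (i : 'I_n) f, W (T (lift ord_max i) f) = T (lift ord0 i) f) /\
  (forall f, W (T ord_max f) = T ord0 (W f)).

Definition isometric_fock_rep (W : K -> K) : Prop :=
  odometer_rep W (@creation R[i] n.+1 E dE) /\ isometry dK dK W.

(* W' is the adjoint of W, which exists and is unique for bounded W. *)
Definition nica_covariant (W : K -> K) : Prop :=
  isometric_fock_rep W /\
  exists2 W' : K -> K, is_adjoint dK dK W W' &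
    forall f, W' (creation ord0 f) = creation ord_max (W' f).

(* The subspace Omega \otimes E. *)
Definition vacuum_space : set K := [set tens dE (evec [::]) x | x in setT].

End Odometer.

Arguments vacuum_space {R} n {E} dE.

(* Main.v *)
Require Import Defs.
From HB Require Import structures.
From mathcomp Require Import all_boot all_order all_algebra.
From mathcomp Require Import complex.
From mathcomp Require Import all_classical all_reals all_analysis.
Set Implicit Arguments.
Unset Strict Implicit.
Unset Printing Implicit Defensive.
Import Order.TTheory GRing.Theory Num.Theory.
Local Open Scope ring_scope.
Local Open Scope classical_set_scope.

(* (1) => (2): as W is isometric and maps S_i f to S_(i+1) f, L x is orthogonal
   to the ranges of S_2, ..., S_n, and Nica covariance makes it orthogonal to the
   range of S_1 as well; so L is an isometry of E into Omega (x) E, which is onto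
   because E has finite dimension.
   (2) => (3): W maps e_v (x) x to e_v' (x) x or e_v' (x) U x, where v' is the
   successor of v in the odometer and U is the unitary L. As the odometer
   permutes the words of each length, inverting this termwise gives a
   square-summable preimage of every vector, without taking limits.
   (3) => (1): the adjoint of W is its inverse, and W S_n = S_1 W. *)

Lemma dot_ext (C : numClosedFieldType) (U : lmodType C)
    (dU : {dot U for Num.conj}) (u v : U) :
  (forall x, dU x u = dU x v) -> u = v.
Proof.
move=> uv; apply/eqP; rewrite -subr_eq0 -(dnorm_eq0 dU).
by rewrite linearBr /= uv subrr.
Qed.

Lemma isometry_inj (C : numClosedFieldType) (U V : lmodType C)
    (dU : {dot U for Num.conj}) (dV : {dot V for Num.conj})
    (f : {linear U -> V}) :
  isometry dV dU f -> injective f.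
Proof.
move=> fi x y fxy; apply/eqP; rewrite -subr_eq0 -(dnorm_eq0 dU) -fi.
by rewrite linearB fxy subrr linear0l.
Qed.

Section Successor.
Variable n : nat.
Implicit Types v w : seq 'I_n.+1.

(* The leftmost letter is the least significant digit, and a carry propagates
   to the right. *)
Fixpoint word_succ w : seq 'I_n.+1 :=
  if w is i :: v then
    if unlift ord_max i is Some j then lift ord0 j :: v
    else ord0 :: word_succ v
  else [::].

Lemma size_word_succ w : size (word_succ w) = size w.
Proof. by elim: w => [|i w IH] //=; case: unliftP => [j _|_] //=; rewrite IH. Qed.

Lemma word_succ_inj : injective word_succ.
Proof.
elim=> [|i v IH] [|j w] //=; try by case: unliftP.
case: unliftP => [i' ->|->]; case: unliftP => [j' ->|->] //= /eqP;
  rewrite eqseq_cons => /andP[].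
- by move=> /eqP/lift_inj -> /eqP ->.
- by move=> _ /eqP/IH ->.
Qed.

(** Words of one length form a finite type, on which injectivity of the successor gives
    bijectivity. *)
Definition tuple_succ k (t : k.-tuple 'I_n.+1) : k.-tuple 'I_n.+1 :=
  tcast (etrans (size_word_succ t) (size_tuple t)) (in_tuple (word_succ t)).

Lemma val_tuple_succ k (t : k.-tuple 'I_n.+1) :
  tuple_succ t = word_succ t :> seq _.
Proof. by rewrite val_tcast. Qed.

Lemma tuple_succ_inj k : injective (@tuple_succ k).
Proof.
move=> s t /(congr1 val) /=; rewrite !val_tuple_succ => /word_succ_inj.
exact: val_inj.
Qed.

Lemma word_succ_surj w : exists v, word_succ v = w.
Proof.
have [g _ gK] := injF_bij (@tuple_succ_inj (size w)).
by exists (g (in_tuple w)); rewrite -val_tuple_succ gK.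
Qed.

End Successor.

Section OdometerRange.
Variables (R : realType) (n : nat) (E : lmodType R[i]).
Variable dE : {dot E for Num.conj}.
Local Notation K := (fock n.+1 dE).
Local Notation dK := (@fdot R[i] n.+1 E dE).

(** Reindexing by [tuple_succ] within each length leaves the truncated norms of [g] unchanged, so a
    bound for [g] still serves. *)
Lemma sqsum_word_succ (V : seq 'I_n.+1 -> E -> E) (g : K) :
  (forall w, isometry dE dE (V w)) ->
  sqsum dE (fun w => V w (g (word_succ w))).
Proof.
move=> Vi; have [M gM] := fockP g; exists M => N.
apply: le_trans (gM N); rewrite /pdot le_eqVlt; apply/orP; left; apply/eqP.
apply: eq_bigr => k _; rewrite [RHS](reindex_inj (@tuple_succ_inj n k)).
by apply: eq_bigr => t _; rewrite Vi val_tuple_succ.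
Qed.

(** W S_n = S_1 W carries [W] past each leading last letter; it reaches the vacuum, where [U] acts,
    only if the carry runs through the whole word. *)
Lemma odometer_evec (U : E -> E) (W : K -> K) v x :
  odometer_rep W (@creation R[i] n.+1 E dE) ->
  (forall y, W (tens dE (evec [::]) y) = tens dE (evec [::]) (U y)) ->
  W (tens dE (evec v) x) =
  tens dE (evec (word_succ v)) (if all (pred1 ord_max) v then U x else x).
Proof.
move=> [WS WSmax] W0; elim: v => [|i v IH] //=.
rewrite -creation_evec -creation_tens; case: unliftP => [j ->|->].
  by rewrite WS creation_tens creation_evec eq_sym (negbTE (neq_lift _ _)).
by rewrite WSmax IH creation_tens creation_evec eqxx.
Qed.

Lemma odometer_surj (U V : E -> E) (W : K -> K) :
  isometry dE dE U -> cancel V U ->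
  isometric_fock_rep W ->
  (forall y, W (tens dE (evec [::]) y) = tens dE (evec [::]) (U y)) ->
  forall g, exists f, W f = g.
Proof.
move=> Ui VK [Wrep Wi] W0 g.
pose twist (T : E -> E) (v : seq 'I_n.+1) x :=
  if all (pred1 ord_max) v then T x else x.
have Vi v : isometry dE dE (twist V v).
  by move=> x y; rewrite /twist; case: ifP => // _; rewrite -Ui !VK.
exists (to_fock (sqsum_word_succ g Vi)); apply: fock_ext => w.
have [v <-] := word_succ_surj w.
(* With v' the successor of v, e_v' (x) y is the image under [W] of e_v (x) [twist V v y]. Since [W]
   is isometric, pairing it with the image of the preimage reduces to a pairing in E at the word
   v. *)
apply: (dot_ext (dU := dE)) => y.
have tK : twist U v (twist V v y) = y by rewrite /twist; case: all.
rewrite -fdot_evec -{1}tK -(odometer_evec v _ Wrep W0) Wi /= fdot_evec /=.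
exact: Vi.
Qed.

Lemma nica_vacuum (L : E -> K) (W : K -> K) :
  odometer_map L W -> nica_covariant W ->
  forall x, L x = tens dE (evec [::]) (L x [::]).
Proof.
move=> [W0 _ _] [[[WS _] Wi]] [W' Wadj W'S] x; apply: fock_ext => -[|i v].
  by rewrite /= /delta eqxx scale1r.
rewrite [RHS]/= /delta /= scale0r; apply: (dot_ext (dU := dE)) => y.
rewrite linear0r -fdot_evec -creation_evec -creation_tens.
have [j ->|->] := unliftP ord0 i.
  by rewrite -WS -W0 Wi creation_tens creation_evec /= fdot_evec /= scale0r linear0r.
(* The adjoint turns S_1 into S_n, whose range is orthogonal to the vacuum vectors. *)
rewrite (hermC dK) /= -W0 Wadj W'S /= fdot_evec.
by rewrite linear0r /= rmorph0 mulr0.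
Qed.

Lemma isometry_vacuum (L : E -> K) (W : K -> K) :
  odometer_map L W -> isometry dK dK W -> isometry dK dE L.
Proof.
by move=> [W0 _ _] Wi x y; rewrite -!W0 Wi /= fdot_evec /= /delta eqxx scale1r.
Qed.

(** A right inverse W' of an isometry is its adjoint: <x, W'y> = <Wx, WW'y> = <Wx, y>. Covariance is
    checked after applying the injective [W]: both sides become S_1 f. *)
Lemma surjective_nica (W : {linear K -> K}) :
  isometric_fock_rep W -> (forall g, exists f, W f = g) -> nica_covariant W.
Proof.
move=> Wrep /choice[W' W'K]; have [[_ WSmax] Wi] := Wrep; split=> //.
exists W' => [x y|f]; first by rewrite -[RHS]Wi W'K.
by apply: (isometry_inj Wi); rewrite W'K WSmax W'K.
Qed.

End OdometerRange.

Theorem theorem1p8 (R : realType) (n : nat) (E : vectType R[i])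
    (dE : {dot E for Num.conj})
    (L : {linear E -> fock n.+1 dE})
    (W : {linear fock n.+1 dE -> fock n.+1 dE}) :
  let dK : {dot fock n.+1 dE for Num.conj} := @fdot R[i] n.+1 E dE in
  bounded_op dE dK L ->
  bounded_op dK dK W ->
  odometer_map L W ->
  isometric_fock_rep W ->
  [<-> nica_covariant W;
       unitary_onto dE dK L (vacuum_space n dE);
       unitary_onto dK dK W setT].
Proof.
move=> dK _ _ WL Wrep; have [W0 _ _] := WL; have [_ Wi] := Wrep.
have Li := isometry_vacuum WL Wi.
tfae=> [nica|[_ rL]|[_ rW]].
- split=> //; have LE := nica_vacuum WL nica.
  pose U x := L x [::].
  have Ulin : linear U by move=> a x y; rewrite /U linearP.
  pose Um := GRing.isLinear.Build R[i] E E _ U Ulin.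
  pose UL : {linear E -> E} := HB.pack U Um.
  have Uinj : injective UL.
    by move=> x y Uxy; apply: (isometry_inj Li); rewrite LE [RHS]LE; congr tens.
  (* Finite dimension enters here: an injective endomorphism of E has full image. *)
  have Usurj x : exists y, U y = x.
    have : x \in limg (linfun UL).
      rewrite lker0_limgf ?memvf//; apply/lker0P => y z.
      by rewrite !lfunE => /Uinj.
    by move=> /memv_imgP[y _ ->]; exists y; rewrite lfunE.
  apply/seteqP; split=> [_ [x _ <-]|_ [x _ <-]].
    by exists (L x [::]) => //; rewrite -LE.
  by have [y <-] := Usurj x; exists y => //; rewrite [LHS]LE.
- split=> //; apply/seteqP; split=> // g _.
  have LE x : L x = tens dE (evec [::]) (L x [::]).
    have : vacuum_space n dE (L x) by rewrite -rL; exists x.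
    by move=> [y _ <-]; apply: fock_ext => w /=; rewrite /delta eqxx scale1r.
  have tens0 x y : fdot (tens dE (evec [::]) x : fock n.+1 dE)
      (tens dE (evec [::]) y) = dE x y.
    by rewrite fdot_evec /= /delta eqxx scale1r.
  have /choice[V VK] x : exists y, L y = tens dE (evec [::]) x.
    have : vacuum_space n dE (tens dE (evec [::]) x) by exists x.
    by rewrite -rL => -[y _ <-]; exists y.
  have [|x|y|f <-] := @odometer_surj R n E dE (fun x => L x [::]) V W _ _ Wrep _ g.
  + by move=> x y; rewrite /= -tens0 -!LE Li.
  + by rewrite VK /= /delta eqxx scale1r.
  + by rewrite W0 -LE.
  by exists f.
- apply: surjective_nica => // g.
  have : range W g by rewrite rW.
  by case=> f _ <-; exists f.
Qed.
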